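(* Let $\mathbb{F}$ be a field of characteristic $2$ and let $((\mu_t,\sigma_t),\mathscr{D}_t)$ be a deformation of order $n$ of a ResLieDer pair $((\mathfrak{g},[2]),\mathscr{D})$ over $\mathbb{F}$. Then $((\mu_t,\sigma_t),\mathscr{D}_t)$ is extensible if and only if its obstruction class $[((\mathrm{Ob}^3_{\mathrm{I}},\mathrm{Ob}^3_{\mathrm{II}}),(\mathrm{Ob}^2_{\mathrm{I}},\mathrm{Ob}^2_{\mathrm{II}}))]\in H^3_{\mathrm{ResLD}}(\mathfrak{g};\mathfrak{g})$ is trivial.
   Context: Over a field $\mathbb{F}$ of characteristic $2$: a restricted Lie algebra $(\mathfrak{g},[2])$ is a Lie algebra with a map $x\mapsto x^{[2]}$ such that $[x^{[2]},y]_{\mathfrak{g}}=[x,[x,y]_{\mathfrak{g}}]_{\mathfrak{g}}$, $(ax)^{[2]}=a^2x^{[2]}$, $(x+y)^{[2]}=x^{[2]}+y^{[2]}+[x,y]_{\mathfrak{g}}$. A ResLieDer pair $((\mathfrak{g},[2]),\mathscr{D})$ is a restricted Lie algebra with a linear derivation $\mathscr{D}$ satisfying $\mathscr{D}(x^{[2]})=[x,\mathscr{D}(x)]_{\mathfrak{g}}$. Cochains with adjoint coefficients. $C^1_{*2}$ is the space of linear maps $\mathfrak{g}\to\mathfrak{g}$. $C^2_{*2}$ is the set of pairs $(\varphi_2,\omega_2)$, $\varphi_2:\wedge^2\mathfrak{g}\to\mathfrak{g}$ alternating bilinear, $\omega_2:\mathfrak{g}\to\mathfrak{g}$ with $\omega_2(ax)=a^2\omega_2(x)$,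 $\omega_2(x+y)=\omega_2(x)+\omega_2(y)+\varphi_2(x,y)$. For $n=3,4$, $C^n_{*2}$ is the set of pairs $(\varphi_n,\omega_n)$ with $\varphi_n:\wedge^n\mathfrak{g}\to\mathfrak{g}$ alternating $n$-linear and $\omega_n:\mathfrak{g}\times\wedge^{n-2}\mathfrak{g}\to\mathfrak{g}$ alternating multilinear in the last $n-2$ arguments, with $\omega_n(ax,z_2,\dots)=a^2\omega_n(x,z_2,\dots)$ and $\omega_n(x+y,z_2,\dots)=\omega_n(x,z_2,\dots)+\omega_n(y,z_2,\dots)+\varphi_n(x,y,z_2,\dots)$. $C^n_{\mathrm{ResLD}}(\mathfrak{g};\mathfrak{g})=C^n_{*2}\times C^{n-1}_{*2}$ for $n\ge2$. Operators. $d^1\varphi_1(x,y)=\varphi_1([x,y]_{\mathfrak{g}})+[x,\varphi_1(y)]_{\mathfrak{g}}+[y,\varphi_1(x)]_{\mathfrak{g}}$; $\omega_{\varphi_1}(x)=\varphi_1(x^{[2]})+[x,\varphi_1(x)]_{\mathfrak{g}}$. For $n\ge2$: $$d^n\varphi_n(z_1,\dots,z_{n+1})=\sum_i[z_i,\varphi_n(z_1,\dots,\hat z_i,\dots,z_{n+1})]_{\mathfrak{g}}+\sum_{i<j}\varphi_n([z_i,z_j]_{\mathfrak{g}},z_1,\dots,\hat z_i,\dots,\hat z_j,\dots,z_{n+1}),$$ $$\begin{aligned}d^n\omega_n(x,z_1,\dots,z_{n-1})=\ &[x,\varphi_n(x,z_1,\dots,z_{n-1})]_{\mathfrak{g}}+\varphi_n(x^{[2]},z_1,\dots,z_{n-1})+\sum_i\varphi_n([x,z_i]_{\mathfrak{g}},x,z_1,\dots,\hat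 z_i,\dots,z_{n-1})\\&+\sum_i[z_i,\omega_n(x,z_1,\dots,\hat z_i,\dots,z_{n-1})]_{\mathfrak{g}}+\sum_{i<j}\omega_n(x,[z_i,z_j]_{\mathfrak{g}},z_1,\dots,\hat z_i,\dots,\hat z_j,\dots,z_{n-1}).\end{aligned}$$ $(\delta\varphi_n)(z_1,\dots,z_n)=\mathscr{D}(\varphi_n(z_1,\dots,z_n))+\sum_i\varphi_n(z_1,\dots,\mathscr{D}(z_i),\dots,z_n)$; $(\delta\omega_n)(x,z_2,\dots,z_{n-1})=\mathscr{D}(\omega_n(x,z_2,\dots,z_{n-1}))+\sum_{i=2}^{n-1}\omega_n(x,z_2,\dots,\mathscr{D}(z_i),\dots,z_{n-1})+\varphi_n(x,\mathscr{D}(x),z_2,\dots,z_{n-1})$. $\vartheta^2((\varphi_2,\omega_2),\varphi_1)=((d^2\varphi_2,d^2\omega_2),(d^1\varphi_1+\delta\varphi_2,\omega_{\varphi_1}+\delta\omega_2))$; $\vartheta^3((\varphi_3,\omega_3),(\varphi_2,\omega_2))=((d^3\varphi_3,d^3\omega_3),(d^2\varphi_2+\delta\varphi_3,d^2\omega_2+\delta\omega_3))$. $Z^3_{\mathrm{ResLD}}=\ker\vartheta^3$, $B^3_{\mathrm{ResLD}}=\mathrm{im}\,\vartheta^2$, $H^3_{\mathrm{ResLD}}=Z^3_{\mathrm{ResLD}}/B^3_{\mathrm{ResLD}}$. Deformations of order $n$. A deformation of order $n$ is $((\mu_t,\sigma_t),\mathscr{D}_t)$ with $\mu_t=\sum_{i=0}^n\mu_it^i$,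 $\sigma_t=\sum_{i=0}^n\sigma_it^i$, $\mathscr{D}_t=\sum_{i=0}^n\mathscr{D}_it^i$, where $((\mu_0,\sigma_0),\mathscr{D}_0)=(([\cdot,\cdot]_{\mathfrak{g}},[2]),\mathscr{D})$, which endows the $\mathbb{F}[[t]]/(t^{n+1})$-module $\mathfrak{g}[[t]]/(t^{n+1})$ with a ResLieDer pair structure. Concretely: $((\mu_i,\sigma_i),\mathscr{D}_i)\in C^2_{\mathrm{ResLD}}(\mathfrak{g};\mathfrak{g})$ for $0\le i\le n$, and for all $0\le k\le n$ and $x,y,z\in\mathfrak{g}$, the following sums over $i+j=k$, $i,j\ge0$, vanish: $\sum(\mu_i(x,\mu_j(y,z))+\mu_i(y,\mu_j(z,x))+\mu_i(z,\mu_j(x,y)))=0$; $\sum(\mu_i(y,\sigma_j(x))+\mu_i(x,\mu_j(x,y)))=0$; $\sum(\mathscr{D}_i(\mu_j(x,y))+\mu_j(x,\mathscr{D}_i(y))+\mu_j(y,\mathscr{D}_i(x)))=0$; $\sum(\mathscr{D}_i(\sigma_j(x))+\mu_j(x,\mathscr{D}_i(x)))=0$. It is extensible if there is $((\mu_{n+1},\sigma_{n+1}),\mathscr{D}_{n+1})\in C^2_{\mathrm{ResLD}}(\mathfrak{g};\mathfrak{g})$ such that $((\mu_t+\mu_{n+1}t^{n+1},\sigma_t+\sigma_{n+1}t^{n+1}),\mathscr{D}_t+\mathscr{D}_{n+1}t^{n+1})$ is a deformation of order $n+1$. Obstruction. Define the 3-cochain $((\mathrm{Ob}^3_{\mathrm{I}},\mathrm{Ob}^3_{\mathrm{II}}),(\mathrm{Ob}^2_{\mathrm{I}},\mathrm{Ob}^2_{\mathrm{II}}))\in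 C^3_{\mathrm{ResLD}}(\mathfrak{g};\mathfrak{g})$ by the following sums over $i+j=n+1$, $i,j>0$: $\mathrm{Ob}^3_{\mathrm{I}}(x,y,z)=\sum(\mu_i(x,\mu_j(y,z))+\mu_i(y,\mu_j(z,x))+\mu_i(z,\mu_j(x,y)))$; $\mathrm{Ob}^3_{\mathrm{II}}(x,y)=\sum(\mu_i(y,\sigma_j(x))+\mu_i(x,\mu_j(x,y)))$; $\mathrm{Ob}^2_{\mathrm{I}}(x,y)=\sum(\mathscr{D}_i(\mu_j(x,y))+\mu_j(x,\mathscr{D}_i(y))+\mu_j(y,\mathscr{D}_i(x)))$; $\mathrm{Ob}^2_{\mathrm{II}}(x)=\sum(\mathscr{D}_i(\sigma_j(x))+\mu_j(x,\mathscr{D}_i(x)))$. Its class in $H^3_{\mathrm{ResLD}}(\mathfrak{g};\mathfrak{g})$ is the obstruction class; it is trivial when the 3-cochain lies in $B^3_{\mathrm{ResLD}}(\mathfrak{g};\mathfrak{g})$. *)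

(* Defs.v *)
From HB Require Import structures.
From mathcomp Require Import all_boot all_algebra.
From mathcomp Require Import ring_quotient generic_quotient.
From mathcomp Require Import boolp functions.

Set Implicit Arguments.
Unset Strict Implicit.
Unset Printing Implicit Defensive.
Import GRing.Theory.
Local Open Scope ring_scope.

(* Ambient function spaces, with the pointwise operations; the cochain spaces
   are carved out of them by the predicates is_cochain. *)
Notation pair2 g := ((g -> g -> g) * (g -> g))%type.
Notation pair3 g := ((g -> g -> g -> g) * (g -> g -> g))%type.
Notation pair4 g := ((g -> g -> g -> g -> g) * (g -> g -> g -> g))%type.
Notation pair2_ResLD g := (pair2 g * (g -> g))%type.
Notation pair3_ResLD g := (pair3 g * pair2 g)%type.
Notation pair4_ResLD g := (pair4 g * pair3 g)%type.

Section Cochains.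
Variables (F : fieldType) (g : lmodType F).

Definition alt_bilinear (f : g -> g -> g) : Prop :=
  [/\ forall x, linear (f x), forall y, linear (f^~ y)
    & forall x, f x x = 0].

Definition alt_trilinear (f : g -> g -> g -> g) : Prop :=
  [/\ forall x y, linear (f x y),
      forall x z, linear (fun y => f x y z),
      forall y z, linear (fun x => f x y z)
    & forall x y, [/\ f x x y = 0, f x y x = 0 & f y x x = 0]].

Definition is_cochain1 (f : g -> g) : Prop := linear f.

Definition is_cochain2 (c : pair2 g) : Prop :=
  [/\ alt_bilinear c.1,
      forall a x, c.2 (a *: x) = a ^+ 2 *: c.2 x
    & forall x y, c.2 (x + y) = c.2 x + c.2 y + c.1 x y].

Definition is_cochain3 (c : pair3 g) : Prop :=
  [/\ alt_trilinear c.1,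
      forall x, linear (c.2 x),
      forall a x z, c.2 (a *: x) z = a ^+ 2 *: c.2 x z
    & forall x y z, c.2 (x + y) z = c.2 x z + c.2 y z + c.1 x y z].

Definition is_cochain2_ResLD (c : pair2_ResLD g) : Prop :=
  is_cochain2 c.1 /\ is_cochain1 c.2.

Definition is_cochain3_ResLD (c : pair3_ResLD g) : Prop :=
  is_cochain3 c.1 /\ is_cochain2 c.2.

(* The axioms are those of characteristic 2; the characteristic itself is a
   hypothesis on F wherever it is needed. *)
Record resLieDer := ResLieDer {
  bracket : g -> g -> g;
  sq : g -> g;
  der : g -> g;
  bracket_alt_bilinear : alt_bilinear bracket;
  bracket_jacobi : forall x y z,
    bracket x (bracket y z) + bracket y (bracket z x)
      + bracket z (bracket x y) = 0;
  bracket_sq : forall x y, bracket (sq x) y = bracket x (bracket x y);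
  sqZ : forall a x, sq (a *: x) = a ^+ 2 *: sq x;
  sqD : forall x y, sq (x + y) = sq x + sq y + bracket x y;
  der_linear : linear der;
  der_bracket : forall x y,
    der (bracket x y) = bracket (der x) y + bracket x (der y);
  der_sq : forall x, der (sq x) = bracket x (der x)
}.

Section Operators.
Variable P : resLieDer.
Local Notation "[ x , y ]" := (bracket P x y) (at level 0, x, y at level 99).
Local Notation D := (der P).

(* The differentials and delta in the degrees where they are used (arguments
   written out; an empty sum over i < j is omitted). In d2 and d3 the second
   component is d omega, with the squared argument first. *)
Definition d1 (f : g -> g) : pair2 g :=
  (fun x y => f [x, y] + [x, f y] + [y, f x],
   fun x => f (sq P x) + [x, f x]).

Definition d2 (c : pair2 g) : pair3 g :=
  let: (f, w) := c in
  (fun x y z => [x, f y z] + [y, f x z] + [z, f x y]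
     + (f [x, y] z + f [x, z] y + f [y, z] x),
   fun x z => [x, f x z] + f (sq P x) z + f [x, z] x + [z, w x]).

Definition d3 (c : pair3 g) : pair4 g :=
  let: (f, w) := c in
  (fun x y z t =>
     [x, f y z t] + [y, f x z t] + [z, f x y t] + [t, f x y z]
     + (f [x, y] z t + f [x, z] y t + f [x, t] y z
        + f [y, z] x t + f [y, t] x z + f [z, t] x y),
   fun x y z =>
     [x, f x y z] + f (sq P x) y z + (f [x, y] x z + f [x, z] x y)
     + ([y, w x z] + [z, w x y]) + w x [y, z]).

Definition delta2 (c : pair2 g) : pair2 g :=
  let: (f, w) := c in
  (fun x y => D (f x y) + (f (D x) y + f x (D y)),
   fun x => D (w x) + f x (D x)).

Definition delta3 (c : pair3 g) : pair3 g :=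
  let: (f, w) := c in
  (fun x y z => D (f x y z) + (f (D x) y z + f x (D y) z + f x y (D z)),
   fun x z => D (w x z) + w x (D z) + f x (D x) z).

Definition theta2 (c : pair2_ResLD g) : pair3_ResLD g :=
  (d2 c.1, d1 c.2 + delta2 c.1).

Definition theta3 (c : pair3_ResLD g) : pair4_ResLD g :=
  (d3 c.1, d2 c.2 + delta3 c.1).

Lemma linearfB (f f' : g -> g) :
  linear f -> linear f' -> linear (fun x => f x - f' x).
Proof. by move=> l l' a u v; rewrite l l' scalerBr opprD addrACA. Qed.

Lemma linear0_B (f : g -> g) :
  linear f -> f 0 = 0 /\ forall u v, f (u - v) = f u - f v.
Proof.
move=> lf; have fB u v : f (u - v) = f u - f v.
  by rewrite -scaleN1r addrC lf scaleN1r addrC.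
by split=> //; rewrite -[X in f X](subrr 0) fB subrr.
Qed.

Lemma br0 x : [x, 0] = 0.
Proof. by case: (bracket_alt_bilinear P) => l _ _; case: (linear0_B (l x)). Qed.

Lemma brB x u v : [x, u - v] = [x, u] - [x, v].
Proof. by case: (bracket_alt_bilinear P) => l _ _; case: (linear0_B (l x)). Qed.

Lemma der0 : D 0 = 0.
Proof. by case: (linear0_B (der_linear P)). Qed.

Lemma derB u v : D (u - v) = D u - D v.
Proof. by case: (linear0_B (der_linear P)). Qed.

Let addBB (a b c d : g) : (a - b) + (c - d) = (a + c) - (b + d).
Proof. by rewrite opprD addrACA. Qed.

Lemma d1B f f' : d1 (f - f') = d1 f - d1 f'.
Proof.
by congr pair; do ?apply: funext => ?; rewrite /= !fctE ?brB ?addBB.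
Qed.

Lemma d2B c c' : d2 (c - c') = d2 c - d2 c'.
Proof.
by case: c c' => [f w] [f' w']; congr pair; do ?apply: funext => ?;
   rewrite /= !fctE ?brB ?addBB.
Qed.

Lemma d3B c c' : d3 (c - c') = d3 c - d3 c'.
Proof.
by case: c c' => [f w] [f' w']; congr pair; do ?apply: funext => ?;
   rewrite /= !fctE ?brB ?addBB.
Qed.

Lemma delta2B c c' : delta2 (c - c') = delta2 c - delta2 c'.
Proof.
by case: c c' => [f w] [f' w']; congr pair; do ?apply: funext => ?;
   rewrite /= !fctE ?derB ?addBB.
Qed.

Lemma delta3B c c' : delta3 (c - c') = delta3 c - delta3 c'.
Proof.
by case: c c' => [f w] [f' w']; congr pair; do ?apply: funext => ?;
   rewrite /= !fctE ?derB ?addBB.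
Qed.

Lemma theta2B c c' : theta2 (c - c') = theta2 c - theta2 c'.
Proof.
case: c c' => [c f] [c' f']; congr pair; first exact: d2B.
rewrite -[LHS]/(d1 (f - f') + delta2 (c - c')) d1B delta2B.
by rewrite addrACA -opprD.
Qed.

Lemma theta3B c c' : theta3 (c - c') = theta3 c - theta3 c'.
Proof.
case: c c' => [c e] [c' e']; congr pair; first exact: d3B.
rewrite -[LHS]/(d2 (e - e') + delta3 (c - c')) d2B delta3B.
by rewrite addrACA -opprD.
Qed.

Lemma cochain2B c c' : is_cochain2 c -> is_cochain2 c' -> is_cochain2 (c - c').
Proof.
move=> [[l1 l2 l3] h1 h2] [[l1' l2' l3'] h1' h2']; split; first split.
- by move=> x; apply: linearfB.
- by move=> y; apply: linearfB.
- by move=> x; rewrite /= !fctE l3 l3' subrr.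
- by move=> a x; rewrite /= !fctE h1 h1' scalerBr.
- by move=> x y; rewrite /= !fctE h2 h2' !addBB.
Qed.

Lemma cochain3B c c' : is_cochain3 c -> is_cochain3 c' -> is_cochain3 (c - c').
Proof.
move=> [[l1 l2 l3 l4] w1 w2 w3] [[l1' l2' l3' l4'] w1' w2' w3'].
split; first split.
- by move=> x y; apply: linearfB.
- by move=> x z; apply: linearfB.
- by move=> y z; apply: linearfB.
- move=> x y; case: (l4 x y) (l4' x y) => e1 e2 e3 [e1' e2' e3'].
  by split; rewrite /= !fctE ?e1 ?e2 ?e3 ?e1' ?e2' ?e3' subrr.
- by move=> x; apply: linearfB.
- by move=> a x z; rewrite /= !fctE w2 w2' scalerBr.
- by move=> x y z; rewrite /= !fctE w3 w3' !addBB.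
Qed.

Lemma linear_cst0 : linear (fun _ : g => 0 : g).
Proof. by move=> a u v; rewrite scaler0 addr0. Qed.

Lemma cochain2_0 : is_cochain2 0.
Proof.
by split; [split=> // ?; apply: linear_cst0 | move=> a x; rewrite scaler0
  | move=> x y; rewrite !addr0].
Qed.

Lemma cochain3_0 : is_cochain3 0.
Proof.
by split; [split=> // *; apply: linear_cst0 | move=> ?; apply: linear_cst0
  | move=> a x z; rewrite scaler0 | move=> x y z; rewrite !addr0].
Qed.

Definition Z3 : {pred pair3_ResLD g} :=
  fun c => `[< is_cochain3_ResLD c /\ theta3 c = 0 >].

Lemma Z3_zmod_closed : zmod_closed Z3.
Proof.
split=> [|c c' /asboolP[[c1 c2] c0] /asboolP[[c1' c2'] c0']]; apply/asboolP.
  split; first by split; [apply: cochain3_0 | apply: cochain2_0].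
  by rewrite -[X in theta3 X](subrr 0) theta3B subrr.
by rewrite theta3B c0 c0' subrr; do 2!split=> //;
   [apply: cochain3B | apply: cochain2B].
Qed.

HB.instance Definition _ := GRing.isZmodClosed.Build _ Z3 Z3_zmod_closed.

Record Z3_ResLD := Z3Cocycle { cocycle_val : pair3_ResLD g; _ : cocycle_val \in Z3 }.
HB.instance Definition _ := [isSub for cocycle_val].
HB.instance Definition _ := [Choice of Z3_ResLD by <:].
HB.instance Definition _ := [SubChoice_isSubZmodule of Z3_ResLD by <:].

(* Since theta2 maps cochains into Z3 (theta2_cocycle below), this is exactly the
   image of theta2, seen inside Z3. *)
Definition B3 : {pred Z3_ResLD} :=
  fun z => `[< exists2 c, is_cochain2_ResLD c & theta2 c = val z >].

Lemma B3_zmod_closed : zmod_closed B3.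
Proof.
split=> [|z z' /asboolP[c [c1 c2] ez] /asboolP[c' [c1' c2'] ez']].
  apply/asboolP; exists 0; first by split; [apply: cochain2_0|apply: linear_cst0].
  by rewrite -[X in theta2 X](subrr 0) theta2B subrr raddf0.
apply/asboolP; exists (c - c'); first by split; [apply: cochain2B|apply: linearfB].
by rewrite theta2B ez ez' raddfB.
Qed.

HB.instance Definition _ := GRing.isZmodClosed.Build _ B3 B3_zmod_closed.

Definition H3_ResLD := Quotient.quot B3.
HB.instance Definition _ := GRing.Zmodule.on H3_ResLD.

End Operators.

(* Coefficients: ((c i).1.1, (c i).1.2, (c i).2) = (mu_i, sigma_i, D_i). *)
Section Deformations.
Variables (P : resLieDer) (n : nat).
Implicit Type c : nat -> pair2_ResLD g.

Definition jac_term c (i j : nat) (x y z : g) : g :=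
  (c i).1.1 x ((c j).1.1 y z) + (c i).1.1 y ((c j).1.1 z x)
  + (c i).1.1 z ((c j).1.1 x y).

Definition sq_term c (i j : nat) (x y : g) : g :=
  (c i).1.1 y ((c j).1.2 x) + (c i).1.1 x ((c j).1.1 x y).

Definition der_term c (i j : nat) (x y : g) : g :=
  (c i).2 ((c j).1.1 x y) + (c j).1.1 x ((c i).2 y) + (c j).1.1 y ((c i).2 x).

Definition dersq_term c (i j : nat) (x : g) : g :=
  (c i).2 ((c j).1.2 x) + (c j).1.1 x ((c i).2 x).

(* Only the coefficients c i with i <= n matter: the values beyond are junk. *)
Definition is_deformation c : Prop :=
  [/\ c 0%N = ((bracket P, sq P), der P),
      forall i, (i <= n)%N -> is_cochain2_ResLD (c i)
    & forall k, (k <= n)%N ->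
      [/\ forall x y z, \sum_(i < k.+1) jac_term c i (k - i) x y z = 0,
          forall x y, \sum_(i < k.+1) sq_term c i (k - i) x y = 0,
          forall x y, \sum_(i < k.+1) der_term c i (k - i) x y = 0
        & forall x, \sum_(i < k.+1) dersq_term c i (k - i) x = 0]].

Record deformation := Deformation {
  coef :> nat -> pair2_ResLD g;
  deformationP : is_deformation coef
}.

(* i ranges over 1..n, so that i and j = n + 1 - i are both positive. *)
Definition ob_cochain (T : deformation) : pair3_ResLD g :=
  ((fun x y z => \sum_(1 <= i < n.+1) jac_term T i (n.+1 - i) x y z,
    fun x y => \sum_(1 <= i < n.+1) sq_term T i (n.+1 - i) x y),
   (fun x y => \sum_(1 <= i < n.+1) der_term T i (n.+1 - i) x y,
    fun x => \sum_(1 <= i < n.+1) dersq_term T i (n.+1 - i) x)).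

End Deformations.

Definition extensible (P : resLieDer) (n : nat) (T : deformation P n) : Prop :=
  exists2 e, is_cochain2_ResLD e
    & is_deformation P n.+1 (fun i => if i == n.+1 then e else T i).

End Cochains.

(* ob_cocycle: the obstruction cochain is a cocycle, so that it has a class in
   H3_ResLD; theta2_cocycle: the image of theta2 lies in Z3. Both come from the
   fact that the defects (fjac, fsq, fder, fdersq) of any symmetric biadditive
   B and additive D satisfy the cocycle identities formally; these are applied
   to formal power series and read off at the order of the first nonzero
   defect. *)
Module ObstructionCocycle.

(* Cancellation of equal terms in a sum, when x + x = 0. *)
Section Cancel.
Variables (V : zmodType) (V2 : forall x : V, x + x = 0).

Lemma cancel_step (a r r' : V) : r = a + r' -> r' = 0 -> a + r = 0.
Proof. by move=> -> ->; rewrite addr0 V2. Qed.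

Lemma cancel_pick (a b r r' : V) : r = a + r' -> b + r = a + (b + r').
Proof. by move=> ->; rewrite addrCA. Qed.

Lemma eq2 (a b : V) : a + b = 0 -> a = b.
Proof. by move=> ab; rewrite -[LHS]addr0 -(V2 b) addrA ab add0r. Qed.
End Cancel.

Ltac cancel_find :=
  match goal with
  | |- ?a + ?r = ?a + _ => reflexivity
  | |- ?a = ?a + _ => exact (esym (addr0 a))
  | |- _ => apply: cancel_pick; cancel_find
  end.
Ltac cancel2 V2 := rewrite -?addrA;
  repeat match goal with |- ?a + ?r = 0 =>
    let r' := open_constr:(_) in
    refine (@cancel_step _ V2 a r r' _ _); [cancel_find | ] end;
  try reflexivity.

Section FormalIdentities.
Variables (G : zmodType) (G2 : forall u : G, u + u = 0).
Variables (B : G -> G -> G) (D : G -> G).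
Hypothesis BC : forall u v, B u v = B v u.
Hypothesis BDr : forall u v w, B u (v + w) = B u v + B u w.
Hypothesis DD : forall u v, D (u + v) = D u + D v.

Let BDl u v w : B (u + v) w = B u w + B v w.
Proof. by rewrite BC BDr !(BC w). Qed.

Definition fjac u v w := B u (B v w) + B v (B w u) + B w (B u v).
Definition fsq x s u := B u s + B x (B x u).
Definition fder u v := D (B u v) + B u (D v) + B v (D u).
Definition fdersq x s := D s + B x (D x).

Lemma fjac_cocycle x y z t :
  B x (fjac y z t) + B y (fjac x z t) + B z (fjac x y t) + B t (fjac x y z)
  + (fjac (B x y) z t + fjac (B x z) y t + fjac (B x t) y z
     + fjac (B y z) x t + fjac (B y t) x z + fjac (B z t) x y) = 0.
Proof.
rewrite /fjac !BDr ?(BC y x) ?(BC z x) ?(BC t x) ?(BC z y) ?(BC t y) ?(BC t z).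
rewrite ?(BC (B _ _) x) ?(BC (B _ _) y) ?(BC (B _ _) z) ?(BC (B _ _) t).
rewrite (BC (B z t)) (BC (B y t)) (BC (B y z)).
cancel2 G2.
Qed.

Lemma fsq_cocycle x s y z :
  B x (fjac x y z) + fjac s y z + (fjac (B x y) x z + fjac (B x z) x y)
  + (B y (fsq x s z) + B z (fsq x s y)) + fsq x s (B y z) = 0.
Proof.
rewrite /fjac /fsq !BDr ?(BC y x) ?(BC z x) ?(BC z y) ?(BC y s) ?(BC z s).
rewrite ?(BC (B _ _) x) ?(BC (B _ _) y) ?(BC (B _ _) z) ?(BC (B _ _) s).
rewrite (BC (B x z)).
cancel2 G2.
Qed.

Lemma fder_cocycle x y z :
  B x (fder y z) + B y (fder x z) + B z (fder x y)
  + (fder (B x y) z + fder (B x z) y + fder (B y z) x)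
  + (D (fjac x y z) + (fjac (D x) y z + fjac x (D y) z + fjac x y (D z))) = 0.
Proof.
rewrite /fjac /fder ?(DD, BDr) ?(BC y x) ?(BC z x) ?(BC z y).
rewrite ?(BC (D _) x) ?(BC (D _) y) ?(BC (D _) z).
rewrite ?(BC (B _ _) x) ?(BC (B _ _) y) ?(BC (B _ _) z) ?(BC (D _) (B _ _)).
cancel2 G2.
Qed.

Lemma fdersq_cocycle x s z :
  B x (fder x z) + fder s z + fder (B x z) x + B z (fdersq x s)
  + (D (fsq x s z) + fsq x s (D z) + fjac x (D x) z) = 0.
Proof.
rewrite /fjac /fder /fsq /fdersq ?(DD, BDr) ?(BC z x) ?(BC s z).
rewrite ?(BC (D _) x) ?(BC (D _) s) ?(BC (D _) z).
rewrite ?(BC (B _ _) x) ?(BC (B _ _) z) ?(BC (D _) (B _ _)).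
cancel2 G2.
Qed.
End FormalIdentities.

(* Sequences u : nat -> g stand for formal power series in t. *)
Section Series.
Variables (F : fieldType) (g : lmodType F) (charF : 2%N \in [pchar F]).
Variables (c : nat -> pair2_ResLD g) (cP : forall i, is_cochain2_ResLD (c i)).
Notation G := (nat -> g).

Lemma g2 (x : g) : x + x = 0.
Proof. by rewrite -mulr2n -scaler_nat (pcharf0 charF) scale0r. Qed.

Lemma G2 (u : G) : u + u = 0.
Proof. by apply: funext => k; rewrite !fctE g2. Qed.

Lemma linearD (f : g -> g) : linear f -> forall x y, f (x + y) = f x + f y.
Proof. by move=> l x y; have := l 1 x y; rewrite !scale1r. Qed.

Lemma muDr i x y z : (c i).1.1 x (y + z) = (c i).1.1 x y + (c i).1.1 x z.
Proof. by case: (cP i) => [[[l _ _] _ _] _]; exact: (linearD (l x) y z). Qed.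

Lemma muDl i x y z : (c i).1.1 (y + z) x = (c i).1.1 y x + (c i).1.1 z x.
Proof. by case: (cP i) => [[[_ l _] _ _] _]; exact: (linearD (l x) y z). Qed.

Lemma mu_alt i x : (c i).1.1 x x = 0.
Proof. by case: (cP i) => [[[_ _ a] _ _] _]. Qed.

Lemma muC i x y : (c i).1.1 x y = (c i).1.1 y x.
Proof.
apply: (eq2 g2); rewrite -(mu_alt i (x + y)) muDr !muDl !mu_alt addr0 add0r.
by rewrite addrC.
Qed.

Lemma DiD i x y : (c i).2 (x + y) = (c i).2 x + (c i).2 y.
Proof. by case: (cP i) => _ l; exact: (linearD l x y). Qed.

Lemma add0_0 (f : g -> g) : (forall x y, f (x + y) = f x + f y) -> f 0 = 0.
Proof. by move=> fD; rewrite -[X in f X]addr0 fD g2. Qed.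

Lemma mu0r i x : (c i).1.1 x 0 = 0. Proof. exact: add0_0 (muDr i x). Qed.
Lemma mu0l i x : (c i).1.1 0 x = 0. Proof. by rewrite muC mu0r. Qed.
Lemma Di0 i : (c i).2 0 = 0. Proof. exact: add0_0 (DiD i). Qed.

Definition B (u v : G) : G := fun k =>
  \sum_(i < k.+1) \sum_(j < k.+1)
    if (i + j <= k)%N then (c (k - (i + j))).1.1 (u i) (v j) else 0.
Definition DD (u : G) : G := fun k => \sum_(i < k.+1) (c (k - i)).2 (u i).
Definition SS (x : g) : G := fun k => (c k).1.2 x.
Definition cs0 (x : g) : G := fun k => if k is 0%N then x else 0.
Definition sh (u : G) : G := fun k => if k is k'.+1 then u k' else 0.

Lemma BC u v : B u v = B v u.
Proof.
apply: funext => k; rewrite /B exchange_big; apply: eq_bigr => i _.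
by apply: eq_bigr => j _; rewrite addnC muC.
Qed.

Lemma BDr u v w : B u (v + w) = B u v + B u w.
Proof.
apply: funext => k; rewrite !fctE /B -big_split; apply: eq_bigr => i _.
rewrite -big_split; apply: eq_bigr => j _ /=.
by case: ifP; rewrite ?addr0 // muDr.
Qed.

Lemma DDD u v : DD (u + v) = DD u + DD v.
Proof.
by apply: funext => k; rewrite !fctE /DD -big_split; apply: eq_bigr => i _; rewrite DiD.
Qed.

(* Linearity over the power series variable, which acts by sh. *)
Definition tlin (K : G -> G) :=
  (forall u v, K (u + v) = K u + K v) /\ (forall u, K (sh u) = sh (K u)).

Lemma shD u v : sh (u + v) = sh u + sh v.
Proof. by apply: funext => -[|k]; rewrite !fctE //= addr0. Qed.

Lemma tlin_comp K L : tlin K -> tlin L -> tlin (fun u => K (L u)).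
Proof. by move=> [a b] [a' b']; split=> *; rewrite ?a' ?a ?b' ?b. Qed.

Lemma tlin_add K L : tlin K -> tlin L -> tlin (fun u => K u + L u).
Proof. by move=> [a b] [a' b']; split=> *; rewrite ?a ?a' ?b ?b' ?shD // addrACA. Qed.

Lemma tlinD : tlin DD.
Proof.
split=> [|u]; first exact: DDD.
apply: funext => -[|k]; rewrite /DD big_ord_recl /= Di0 add0r ?big_ord0 //.
Qed.

Lemma tlinBl v : tlin (B^~ v).
Proof.
split=> [u w|u]; first by rewrite BC BDr !(BC v).
apply: funext => -[|k]; rewrite /B big_ord_recl /= big1 ?add0r.
- by rewrite big_ord0.
- by move=> j _; rewrite mu0l if_same.
- apply: eq_bigr => i _; rewrite big_ord_recr /=.
  by rewrite ifN ?addr0 // -ltnNge /bump add1n addSn ltnS leq_addl.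
- by move=> j _; rewrite mu0l if_same.
Qed.

Lemma tlinBr v : tlin (B v).
Proof. by rewrite (_ : B v = B^~ v); [apply: tlinBl | apply: funext => u; rewrite BC]. Qed.

Lemma series_split u : u = cs0 (u 0%N) + sh (fun k => u k.+1).
Proof. by apply: funext => -[|k]; rewrite !fctE /= ?addr0 ?add0r. Qed.

Lemma tlin_lead K n : tlin K ->
  (forall x m, (m <= n)%N -> K (cs0 x) m = 0) ->
  forall u, K u n.+1 = K (cs0 (u 0%N)) n.+1.
Proof.
move=> [KD Ksh] K0.
have Kn m : (m <= n)%N -> forall u, K u m = 0.
  elim: m => [|m IH] mn u; rewrite (series_split u) KD Ksh !fctE K0 //= add0r //.
  exact/IH/ltnW.
by move=> u; rewrite {1}(series_split u) KD Ksh !fctE /= (Kn n) // addr0.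
Qed.

Lemma B_cstl x v k : B (cs0 x) v k = \sum_(j < k.+1) (c (k - j)).1.1 x (v j).
Proof.
rewrite /B big_ord_recl [X in _ + X]big1 ?addr0.
  by apply: eq_bigr => j _; rewrite /= add0n -ltnS ltn_ord.
by move=> i _; rewrite big1 // => j _; rewrite /= mu0l if_same.
Qed.

Lemma B_lead x u n : (forall m, (m <= n)%N -> u m = 0) ->
  B (cs0 x) u n.+1 = (c 0%N).1.1 x (u n.+1).
Proof.
move=> u0; rewrite B_cstl big_ord_recr /= subnn big1 ?add0r // => i _.
by rewrite u0 ?mu0r // -ltnS.
Qed.

Lemma D_lead u n : (forall m, (m <= n)%N -> u m = 0) ->
  DD u n.+1 = (c 0%N).2 (u n.+1).
Proof.
move=> u0; rewrite /DD big_ord_recr /= subnn big1 ?add0r // => i _.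
by rewrite u0 ?Di0 // -ltnS.
Qed.

Lemma Bcc x y k : B (cs0 x) (cs0 y) k = (c k).1.1 x y.
Proof.
rewrite B_cstl big_ord_recl /= subn0 big1 ?addr0 // => i _; exact: mu0r.
Qed.

Lemma Dc x k : DD (cs0 x) k = (c k).2 x.
Proof. rewrite /DD big_ord_recl /= subn0 big1 ?addr0 // => i _; exact: Di0. Qed.

Lemma rev_sum k (f : nat -> nat -> g) :
  \sum_(i < k.+1) f (k - i)%N i = \sum_(i < k.+1) f i (k - i)%N.
Proof.
rewrite (reindex_inj rev_ord_inj); apply: eq_bigr => i _ /=.
by rewrite subSS subKn // -ltnS.
Qed.

Lemma sumBcc x (f : nat -> g) k :
  \sum_(i < k.+1) (c (k - i)).1.1 x (f i) = \sum_(i < k.+1) (c i).1.1 x (f (k - i)%N).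
Proof. exact: (rev_sum k (fun a b => (c a).1.1 x (f b))). Qed.

Notation jac := (fjac B).
Lemma jac_coef x y z k :
  jac (cs0 x) (cs0 y) (cs0 z) k = \sum_(i < k.+1) jac_term c i (k - i) x y z.
Proof.
rewrite /fjac !fctE !B_cstl.
under eq_bigr do rewrite Bcc.
under [X in _ + X + _]eq_bigr do rewrite Bcc.
under [X in _ + X]eq_bigr do rewrite Bcc.
by rewrite (sumBcc x (fun j => (c j).1.1 y z)) (sumBcc y (fun j => (c j).1.1 z x)) (sumBcc z (fun j => (c j).1.1 x y)) -!big_split.
Qed.

Lemma sq_coef x y k :
  fsq B (cs0 x) (SS x) (cs0 y) k = \sum_(i < k.+1) sq_term c i (k - i) x y.
Proof.
rewrite /fsq !fctE !B_cstl.
under [X in _ + X]eq_bigr do rewrite Bcc.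
by rewrite (sumBcc y (SS x)) (sumBcc x (fun j => (c j).1.1 x y)) -!big_split.
Qed.

Lemma der_coef x y k :
  fder B DD (cs0 x) (cs0 y) k = \sum_(i < k.+1) der_term c i (k - i) x y.
Proof.
rewrite /fder !fctE !B_cstl [X in X + _ + _]/DD.
under eq_bigr do rewrite Bcc.
under [X in _ + X + _]eq_bigr do rewrite Dc.
under [X in _ + X]eq_bigr do rewrite Dc.
rewrite (rev_sum k (fun a b => (c a).2 ((c b).1.1 x y))).
by rewrite -!big_split.
Qed.

Lemma dersq_coef x k :
  fdersq B DD (cs0 x) (SS x) k = \sum_(i < k.+1) dersq_term c i (k - i) x.
Proof.
rewrite /fdersq !fctE !B_cstl [X in X + _]/DD.
under [X in _ + X]eq_bigr do rewrite Dc.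
rewrite (rev_sum k (fun a b => (c a).2 ((c b).1.2 x))).
by rewrite -!big_split.
Qed.

Lemma tlin_jac1 y z : tlin (fun u => jac u y z).
Proof.
apply: tlin_add; first apply: tlin_add; first exact: tlinBl.
  exact: tlin_comp (tlinBr y) (tlinBr z).
exact: tlin_comp (tlinBr z) (tlinBl y).
Qed.

Lemma jac_rot x y z : jac x y z = jac y z x.
Proof. by rewrite /fjac -addrA addrC. Qed.

Lemma tlin_jac2 y z : tlin (fun u => jac y u z).
Proof.
by rewrite (_ : (fun u => _) = fun u => jac u z y);
  [apply: tlin_jac1 | apply: funext => u; rewrite jac_rot].
Qed.

Lemma tlin_jac3 y z : tlin (fun u => jac y z u).
Proof.
by rewrite (_ : (fun u => _) = fun u => jac u y z);
  [apply: tlin_jac1 | apply: funext => u; rewrite 2!jac_rot].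
Qed.

Lemma tlin_sq x s : tlin (fsq B x s).
Proof.
apply: tlin_add; first exact: tlinBl.
exact: tlin_comp (tlinBr x) (tlinBr x).
Qed.

Lemma tlin_der v : tlin (fun u => fder B DD u v).
Proof.
apply: tlin_add; first apply: tlin_add.
- exact: tlin_comp tlinD (tlinBl v).
- exact: tlinBl.
- exact: tlin_comp (tlinBr v) tlinD.
Qed.


Lemma muZr i a x y : (c i).1.1 x (a *: y) = a *: (c i).1.1 x y.
Proof.
case: (cP i) => [[[l _ _] _ _] _].
by have := l x a y 0; rewrite mu0r !addr0.
Qed.

Lemma muZl i a x y : (c i).1.1 (a *: x) y = a *: (c i).1.1 x y.
Proof. by rewrite muC muZr muC. Qed.

Lemma DiZ i a x : (c i).2 (a *: x) = a *: (c i).2 x.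
Proof. by case: (cP i) => _ l; have := l a x 0; rewrite Di0 !addr0. Qed.

Lemma sigmaZ i a x : (c i).1.2 (a *: x) = a ^+ 2 *: (c i).1.2 x.
Proof. by case: (cP i) => [[_ h _] _]. Qed.

Lemma sigmaD i x y :
  (c i).1.2 (x + y) = (c i).1.2 x + (c i).1.2 y + (c i).1.1 x y.
Proof. by case: (cP i) => [[_ _ h] _]. Qed.

Lemma linear_of (f : g -> g) : (forall x y, f (x + y) = f x + f y) ->
  (forall a x, f (a *: x) = a *: f x) -> linear f.
Proof. by move=> fD fZ a x y; rewrite fD fZ. Qed.

Definition muE := (muZr, muZl, DiZ, muDr, muDl, DiD, scalerDr, sigmaD, sigmaZ).

Lemma jac_sq_cochain i j : is_cochain3 (jac_term c i j, sq_term c i j).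
Proof.
split; first split.
- by move=> x y; apply: linear_of => [u v|a u];
     rewrite /= /jac_term !muE //; apply: (eq2 g2); cancel2 g2.
- by move=> x y; apply: linear_of => [u v|a u];
     rewrite /= /jac_term !muE //; apply: (eq2 g2); cancel2 g2.
- by move=> x y; apply: linear_of => [u v|a u];
     rewrite /= /jac_term !muE //; apply: (eq2 g2); cancel2 g2.
- by move=> x y; split; rewrite /= /jac_term (muC j y x) mu_alt mu0r; cancel2 g2;
     rewrite ?add0r ?addr0 ?g2.
- by move=> x; apply: linear_of => [u v|a u];
     rewrite /= /sq_term !muE //; apply: (eq2 g2); cancel2 g2.
- by move=> a x z; rewrite /= /sq_term !muE scalerA -expr2.
- move=> x y z; rewrite /= /sq_term /jac_term !muE (muC j z x).
  by apply: (eq2 g2); cancel2 g2.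
Qed.

Lemma der_dersq_cochain i j : is_cochain2 (der_term c i j, dersq_term c i j).
Proof.
split; first split.
- by move=> x; apply: linear_of => [u v|a u];
     rewrite /= /der_term !muE //; apply: (eq2 g2); cancel2 g2.
- by move=> x; apply: linear_of => [u v|a u];
     rewrite /= /der_term !muE //; apply: (eq2 g2); cancel2 g2.
- by move=> x; rewrite /= /der_term mu_alt Di0 add0r g2.
- by move=> a x; rewrite /= /dersq_term !muE scalerA -expr2.
- move=> x y; rewrite /= /dersq_term /der_term !muE.
  by apply: (eq2 g2); cancel2 g2.
Qed.

End Series.

Section Sums.
Variables (F : fieldType) (g : lmodType F).

Lemma cochain2D (e e' : pair2 g) :
  is_cochain2 e -> is_cochain2 e' -> is_cochain2 (e + e').
Proof.
move=> h h'; rewrite -[e']opprK -[- e']add0r.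
exact/(cochain2B h)/(cochain2B (cochain2_0 g) h').
Qed.

Lemma cochain3D (e e' : pair3 g) :
  is_cochain3 e -> is_cochain3 e' -> is_cochain3 (e + e').
Proof.
move=> h h'; rewrite -[e']opprK -[- e']add0r.
exact/(cochain3B h)/(cochain3B (cochain3_0 g) h').
Qed.

Lemma cochain2_sum (I : Type) (s : seq I) (f : I -> g -> g -> g) (w : I -> g -> g) :
  (forall i, is_cochain2 (f i, w i)) ->
  is_cochain2 (fun x y => \sum_(i <- s) f i x y, fun x => \sum_(i <- s) w i x).
Proof.
move=> fw; elim: s => [|a s IH].
  rewrite (_ : (_, _) = 0); first exact: cochain2_0.
  by congr pair; do ?apply: funext => ?; rewrite big_nil.
rewrite (_ : (_, _) = (f a, w a) +
  (fun x y => \sum_(i <- s) f i x y, fun x => \sum_(i <- s) w i x)).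
  exact: cochain2D.
by congr pair; do ?apply: funext => ?; rewrite big_cons.
Qed.

Lemma cochain3_sum (I : Type) (s : seq I) (f : I -> g -> g -> g -> g)
  (w : I -> g -> g -> g) :
  (forall i, is_cochain3 (f i, w i)) ->
  is_cochain3 (fun x y z => \sum_(i <- s) f i x y z,
               fun x y => \sum_(i <- s) w i x y).
Proof.
move=> fw; elim: s => [|a s IH].
  rewrite (_ : (_, _) = 0); first exact: cochain3_0.
  by congr pair; do ?apply: funext => ?; rewrite big_nil.
rewrite (_ : (_, _) = (f a, w a) + (fun x y z => \sum_(i <- s) f i x y z,
               fun x y => \sum_(i <- s) w i x y)).
  exact: cochain3D.
by congr pair; do ?apply: funext => ?; rewrite big_cons.
Qed.

End Sums.

Section Defect.
Variables (F : fieldType) (g : lmodType F) (charF : 2%N \in [pchar F]).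

(* The coefficients of t^k in the equations of a deformation *)
Definition defect (c : nat -> pair2_ResLD g) (k : nat) : pair3_ResLD g :=
  ((fun x y z => \sum_(i < k.+1) jac_term c i (k - i) x y z,
    fun x y => \sum_(i < k.+1) sq_term c i (k - i) x y),
   (fun x y => \sum_(i < k.+1) der_term c i (k - i) x y,
    fun x => \sum_(i < k.+1) dersq_term c i (k - i) x)).

Variables (P : resLieDer g) (n : nat) (c : nat -> pair2_ResLD g).
Hypothesis cP : forall i, is_cochain2_ResLD (c i).
Hypothesis c0 : c 0%N = ((bracket P, sq P), der P).
Hypothesis c_low : forall m, (m <= n)%N -> defect c m = 0.

Notation B := (B c).
Notation D := (DD c).
Notation "^ x" := (cs0 x) (at level 5).
Notation jac := (fjac B).
Notation S x := (SS c x).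

Let Ob1 := (defect c n.+1).1.1.
Let Ob2 := (defect c n.+1).1.2.
Let Ob3 := (defect c n.+1).2.1.
Let Ob4 := (defect c n.+1).2.2.

Let jac_low x y z m : (m <= n)%N -> jac ^x ^y ^z m = 0.
Proof. by rewrite jac_coef // => /c_low e; exact: (congr1 (fun d => d.1.1 x y z) e). Qed.

Let sq_low x y m : (m <= n)%N -> fsq B ^x (S x) ^y m = 0.
Proof. by rewrite sq_coef // => /c_low e; exact: (congr1 (fun d => d.1.2 x y) e). Qed.

Let der_low x y m : (m <= n)%N -> fder B D ^x ^y m = 0.
Proof. by rewrite der_coef // => /c_low e; exact: (congr1 (fun d => d.2.1 x y) e). Qed.

Let dersq_low x m : (m <= n)%N -> fdersq B D ^x (S x) m = 0.
Proof. by rewrite dersq_coef // => /c_low e; exact: (congr1 (fun d => d.2.2 x) e). Qed.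

Let jac_top x y z : jac ^x ^y ^z n.+1 = Ob1 x y z.
Proof. exact: jac_coef. Qed.

Let sq_top x y : fsq B ^x (S x) ^y n.+1 = Ob2 x y.
Proof. exact: sq_coef. Qed.

Let der_top x y : fder B D ^x ^y n.+1 = Ob3 x y.
Proof. exact: der_coef. Qed.

Let dersq_top x : fdersq B D ^x (S x) n.+1 = Ob4 x.
Proof. exact: dersq_coef. Qed.

Let jac1 u y z : jac u ^y ^z n.+1 = Ob1 (u 0%N) y z.
Proof.
rewrite (tlin_lead (tlin_jac1 charF cP ^y ^z)) ?jac_top // => x m.
exact: jac_low.
Qed.

Let jac2 u y z : jac ^y u ^z n.+1 = Ob1 y (u 0%N) z.
Proof.
rewrite (tlin_lead (tlin_jac2 charF cP ^y ^z)) ?jac_top // => x m.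
exact: jac_low.
Qed.

Let jac3 u y z : jac ^y ^z u n.+1 = Ob1 y z (u 0%N).
Proof.
rewrite (tlin_lead (tlin_jac3 charF cP ^y ^z)) ?jac_top // => x m.
exact: jac_low.
Qed.

Let sq1 x u : fsq B ^x (S x) u n.+1 = Ob2 x (u 0%N).
Proof.
rewrite (tlin_lead (tlin_sq charF cP ^x (S x))) ?sq_top // => y m.
exact: sq_low.
Qed.

Let der1 u y : fder B D u ^y n.+1 = Ob3 (u 0%N) y.
Proof.
rewrite (tlin_lead (tlin_der charF cP ^y)) ?der_top // => x m.
exact: der_low.
Qed.

Let Blead x u : (forall m, (m <= n)%N -> u m = 0) ->
  B ^x u n.+1 = bracket P x (u n.+1).
Proof. by move=> h; rewrite B_lead // c0. Qed.

Let Dlead u : (forall m, (m <= n)%N -> u m = 0) -> D u n.+1 = der P (u n.+1).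
Proof. by move=> h; rewrite D_lead // c0. Qed.

Let B0 x y : B ^x ^y 0%N = bracket P x y. Proof. by rewrite Bcc // c0. Qed.
Let DD0 x : D ^x 0%N = der P x. Proof. by rewrite Dc // c0. Qed.
Let S0 x : S x 0%N = sq P x. Proof. by rewrite /SS c0. Qed.

Let Bjac w x y z : B ^w (jac ^x ^y ^z) n.+1 = bracket P w (Ob1 x y z).
Proof. by rewrite Blead ?jac_top // => m; apply: jac_low. Qed.

Let Bsq w x y : B ^w (fsq B ^x (S x) ^y) n.+1 = bracket P w (Ob2 x y).
Proof. by rewrite Blead ?sq_top // => m; apply: sq_low. Qed.

Let Bder w x y : B ^w (fder B D ^x ^y) n.+1 = bracket P w (Ob3 x y).
Proof. by rewrite Blead ?der_top // => m; apply: der_low. Qed.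

Let Bdersq w x : B ^w (fdersq B D ^x (S x)) n.+1 = bracket P w (Ob4 x).
Proof. by rewrite Blead ?dersq_top // => m; apply: dersq_low. Qed.

Let Djac x y z : D (jac ^x ^y ^z) n.+1 = der P (Ob1 x y z).
Proof. by rewrite Dlead ?jac_top // => m; apply: jac_low. Qed.

Let Dsq x y : D (fsq B ^x (S x) ^y) n.+1 = der P (Ob2 x y).
Proof. by rewrite Dlead ?sq_top // => m; apply: sq_low. Qed.

Let topE := (Bjac, Bsq, Bder, Bdersq, Djac, Dsq, jac1, jac2, jac3, sq1, der1, dersq_top, B0, DD0, S0).

Let BC' := BC charF cP.
Let BDr' := BDr cP.
Let DD' := DDD cP.

Lemma defect_cocycle : defect c n.+1 \in Z3 P.
Proof.
apply/asboolP; split.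
  split; first by apply: cochain3_sum => i; apply: jac_sq_cochain.
  by apply: cochain2_sum => i; apply: der_dersq_cochain.
rewrite -[defect c n.+1]/((Ob1, Ob2), (Ob3, Ob4)).
congr pair; congr pair.
- apply: funext => x; apply: funext => y; apply: funext => z; apply: funext => t.
  have := congr1 (fun u : nat -> g => u n.+1)
    (fjac_cocycle (G2 charF) BC' BDr' ^x ^y ^z (cs0 t)).
  by rewrite !fctE !topE.
- apply: funext => x; apply: funext => y; apply: funext => z.
  have := congr1 (fun u : nat -> g => u n.+1)
    (fsq_cocycle (G2 charF) BC' BDr' ^x (S x) ^y ^z).
  by rewrite !fctE !topE.
- apply: funext => x; apply: funext => y; apply: funext => z.
  have := congr1 (fun u : nat -> g => u n.+1)
    (fder_cocycle (G2 charF) BC' BDr' DD' ^x ^y ^z).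
  by rewrite !fctE !topE.
- apply: funext => x; apply: funext => z.
  have := congr1 (fun u : nat -> g => u n.+1)
    (fdersq_cocycle (G2 charF) BC' BDr' DD' ^x (S x) ^z).
  by rewrite !fctE !topE.
Qed.

End Defect.

Section Obstruction.
Variables (F : fieldType) (g : lmodType F) (charF : 2%N \in [pchar F]).
Variables (P : resLieDer g).

Lemma sum_top n (f f' : nat -> nat -> g) :
  (forall i j, (i <= n)%N -> (j <= n)%N -> f i j = f' i j) ->
  f 0%N n.+1 = 0 -> f n.+1 0%N = 0 ->
  \sum_(1 <= i < n.+1) f' i (n.+1 - i)%N = \sum_(i < n.+2) f i (n.+1 - i)%N.
Proof.
move=> fE f0 fS; apply/esym.
rewrite -(big_mkord xpredT (fun i => f i (n.+1 - i)%N)) big_ltn // subn0 f0.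
rewrite add0r big_nat_recr //= subnn fS addr0.
apply: eq_big_nat => -[//|i] /andP[_ i2]; rewrite fE // subSS.
exact: leq_subr.
Qed.

Lemma ob_cocycle n (T : deformation P n) : ob_cochain T \in Z3 P.
Proof.
have [T0 TP Teq] := deformationP T.
pose c i : pair2_ResLD g := if (i <= n)%N then T i else 0.
have cP i : is_cochain2_ResLD (c i).
  rewrite /c; case: ifP => [/TP //|_].
  by split; [exact: cochain2_0 | exact: linear_cst0].
have cT i : (i <= n)%N -> c i = T i by rewrite /c => ->.
have cS : c n.+1 = 0 by rewrite /c ltnn.
have mu0 i x : (c i).1.1 x 0 = 0 by apply: mu0r.
have D0 i : (c i).2 0 = 0 by apply: Di0.
have cl m : (m <= n)%N -> defect c m = 0.
  move=> mn; have [e1 e2 e3 e4] := Teq m mn.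
  have cE (i : 'I_m.+1) : (c i = T i) * (c (m - i)%N = T (m - i)%N).
    split; apply: cT; apply: leq_trans mn; last exact: leq_subr.
    by rewrite -ltnS.
  congr pair; congr pair; apply: funext => x.
  - apply: funext => y; apply: funext => z; apply: etrans (e1 x y z).
    by apply: eq_bigr => i _; rewrite /jac_term !cE.
  - apply: funext => y; apply: etrans (e2 x y).
    by apply: eq_bigr => i _; rewrite /sq_term !cE.
  - apply: funext => y; apply: etrans (e3 x y).
    by apply: eq_bigr => i _; rewrite /der_term !cE.
  - apply: etrans (e4 x).
    by apply: eq_bigr => i _; rewrite /dersq_term !cE.
have -> : ob_cochain T = defect c n.+1.
  congr pair; congr pair; apply: funext => x.
  - apply: funext => y; apply: funext => z.
    apply: (@sum_top n (fun i j => jac_term c i j x y z)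
                       (fun i j => jac_term T i j x y z)) => [i j ni nj||];
      by rewrite /jac_term ?cS /= ?fctE ?mu0 ?addr0 // !cT.
  - apply: funext => y.
    apply: (@sum_top n (fun i j => sq_term c i j x y)
                       (fun i j => sq_term T i j x y)) => [i j ni nj||];
      by rewrite /sq_term ?cS /= ?fctE ?mu0 ?addr0 // !cT.
  - apply: funext => y.
    apply: (@sum_top n (fun i j => der_term c i j x y)
                       (fun i j => der_term T i j x y)) => [i j ni nj||];
      by rewrite /der_term ?cS /= ?fctE ?mu0 ?D0 ?addr0 // !cT.
  - apply: (@sum_top n (fun i j => dersq_term c i j x)
                       (fun i j => dersq_term T i j x)) => [i j ni nj||];
      by rewrite /dersq_term ?cS /= ?fctE ?mu0 ?D0 ?addr0 // !cT.
by apply: defect_cocycle => //; rewrite cT.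
Qed.

Lemma theta2_cocycle e : is_cochain2_ResLD e -> theta2 P e \in Z3 P.
Proof.
move=> eP.
pose c i : pair2_ResLD g :=
  if i is i'.+1 then if i' is 0%N then e else 0 else ((bracket P, sq P), der P).
have cP i : is_cochain2_ResLD (c i).
  case: i => [|[|i]] //=; last by split; [exact: cochain2_0 | exact: linear_cst0].
  split; last exact: der_linear.
  by split; [exact: bracket_alt_bilinear | exact: sqZ | exact: sqD].
have brC x y : bracket P x y = bracket P y x := muC charF cP 0 x y.
have eC x y : e.1.1 x y = e.1.1 y x := muC charF cP 1 x y.
have V2 (x : g) : x + x = 0 := g2 charF x.
have cl m : (m <= 0)%N -> defect c m = 0.
  rewrite leqn0 => /eqP ->; congr pair; congr pair; apply: funext => x;
    do ?apply: funext => ?; rewrite big_ord1.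
  - exact: bracket_jacobi.
  - by rewrite /sq_term /= brC bracket_sq V2.
  - rewrite /der_term /= der_bracket (brC (der P x)).
    by rewrite -(addrA (bracket P _ _)) V2 addr0 V2.
  - by rewrite /dersq_term /= der_sq V2.
have -> : theta2 P e = defect c 1; last exact: defect_cocycle.
rewrite /c; clear c cP cl; case: e eP eC => -[f w] h _ /= eC.
pose c i : pair2_ResLD g := if i is i'.+1 then
  if i' is 0%N then ((f, w), h) else 0 else ((bracket P, sq P), der P).
have sum2 (s : nat -> nat -> g) : \sum_(i < 2) s i (1 - i)%N = s 0%N 1%N + s 1%N 0%N.
  by rewrite big_ord_recl big_ord1.
congr pair; congr pair; apply: funext => x.
- apply: funext => y; apply: funext => z.
  rewrite (sum2 (fun i j => jac_term c i j x y z)) /jac_term /=.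
  rewrite (eC z x) (eC x (bracket P y z)) (eC y (bracket P z x)).
  rewrite (eC z (bracket P x y)) (brC z x).
  by apply: (eq2 V2); cancel2 V2.
- apply: funext => y; rewrite ?fctE (sum2 (fun i j => sq_term c i j x y)).
  rewrite /sq_term /= (eC y (sq P x)) (eC x (bracket P x y)).
  by apply: (eq2 V2); cancel2 V2.
- apply: funext => y; rewrite ?fctE (sum2 (fun i j => der_term c i j x y)).
  rewrite /der_term /= (eC y (der P x)).
  by apply: (eq2 V2); cancel2 V2.
- rewrite ?fctE (sum2 (fun i j => dersq_term c i j x)) /dersq_term /=.
  by apply: (eq2 V2); cancel2 V2.
Qed.
End Obstruction.

End ObstructionCocycle.

Definition obstruction_class (F : fieldType) (charF : 2%N \in [pchar F])
    (g : lmodType F) (P : resLieDer g) (n : nat) (T : deformation P n) :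
    H3_ResLD P :=
  (\pi_(H3_ResLD P) (Z3Cocycle (ObstructionCocycle.ob_cocycle charF T)))%qT.

(* Main.v *)
Require Import Defs.
From mathcomp Require Import all_boot all_algebra.
From mathcomp Require Import ring_quotient generic_quotient.
From mathcomp Require Import boolp functions.

Set Implicit Arguments.
Unset Strict Implicit.
Unset Printing Implicit Defensive.
Import GRing.Theory.
Local Open Scope ring_scope.

(** Let [defect c k] be the 3-cochain formed by the coefficients of [t^k] in
    the four equations of a deformation, so that a deformation of order [n] is
    a family of cochains starting at the given structure whose defects vanish
    up to order [n] ([is_deformationE]).  Prolong the deformation [T] by a
    cochain [e] in degree [n + 1].  The defects up to order [n] do not see
    [e].  In the sum over [i + j = n + 1] defining the next one, the indices
    with [i, j > 0] give the obstruction cochain, while the two extreme terms,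
    in which [e] meets the undeformed structure, give [theta2 e]
    ([defect_extend]).  So [T] is prolonged by [e] exactly when
    [ob_cochain T + theta2 e = 0]; in characteristic 2 this reads
    [theta2 e = ob_cochain T], and the existence of such an [e] is the
    triviality of the obstruction class ([pi_H3_eq0]). *)

Section ExtendedFamily.
Variables (A : Type) (V : zmodType) (T : nat -> A) (n : nat) (e : A).

(** The family [T] with its value in degree [n + 1] replaced by [e]. *)
Definition extend (i : nat) : A := if i == n.+1 then e else T i.

Lemma extend_low i : (i <= n)%N -> extend i = T i.
Proof. by rewrite /extend; case: eqP => // ->; rewrite ltnn. Qed.

Lemma extend_top : extend n.+1 = e.
Proof. by rewrite /extend eqxx. Qed.

(** The summand of each coefficient in the equations of a deformation depends
    on the indices [i], [j] only through the members [i] and [j] of the family: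
    this is the function [h]. *)
Lemma sum_extend_low (h : A -> A -> V) k : (k <= n)%N ->
  \sum_(i < k.+1) h (extend i) (extend (k - i))
  = \sum_(i < k.+1) h (T i) (T (k - i)%N).
Proof.
move=> kn; apply: eq_bigr => i _; rewrite !extend_low //.
  exact: leq_trans (leq_subr _ _) kn.
by apply: leq_trans kn; rewrite -ltnS.
Qed.

Lemma sum_extend_top (h : A -> A -> V) :
  \sum_(i < n.+2) h (extend i) (extend (n.+1 - i))
  = \sum_(1 <= i < n.+1) h (T i) (T (n.+1 - i)%N) + (h (T 0%N) e + h e (T 0%N)).
Proof.
rewrite -(big_mkord xpredT (fun i => h (extend i) (extend (n.+1 - i)))).
rewrite big_ltn // big_nat_recr //= subn0 subnn extend_top !(@extend_low 0) //.
rewrite addrCA; congr (_ + _); apply: eq_big_nat => -[//|i] /andP[_ i_le].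
by rewrite !extend_low // subSS leq_subr.
Qed.

End ExtendedFamily.

Section Obstruction.
Variables (F : fieldType) (charF : 2%N \in [pchar F]) (g : lmodType F).
Variables (P : resLieDer g).

Notation defect := ObstructionCocycle.defect.

Lemma is_deformationE n (c : nat -> pair2_ResLD g) :
  is_deformation P n c <->
  [/\ c 0%N = ((bracket P, sq P), der P),
      forall i, (i <= n)%N -> is_cochain2_ResLD (c i)
    & forall k, (k <= n)%N -> defect c k = 0].
Proof.
split=> -[c0 cP eqs]; split=> // k /eqs.
  by case=> e1 e2 e3 e4; congr pair; congr pair; do ?apply: funext => ?;
    rewrite ?e1 ?e2 ?e3 ?e4.
move=> d0; split=> [x y z|x y|x y|x].
- exact: (congr1 (fun d => d.1.1 x y z) d0).
- exact: (congr1 (fun d => d.1.2 x y) d0).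
- exact: (congr1 (fun d => d.2.1 x y) d0).
- exact: (congr1 (fun d => d.2.2 x) d0).
Qed.

Section Extension.
Variables (n : nat) (T : deformation P n) (e : pair2_ResLD g).

Lemma defect_extend_low k : (k <= n)%N -> defect (extend T n e) k = 0.
Proof.
have [_ _ T_defect] := (is_deformationE n T).1 (deformationP T).
move=> kn; rewrite -[RHS](T_defect k kn).
congr pair; congr pair; apply: funext => x.
(* The summand with members [a] and [b] at the indices [i] and [j] is its value
   at the indices 0 and 1 for a family that starts with [a] and [b]. *)
- apply: funext => y; apply: funext => z.
  exact: (@sum_extend_low _ g T n e (fun a b => jac_term
            (fun i => if i is 0%N then a else b) 0 1 x y z) k kn).
- apply: funext => y.
  exact: (@sum_extend_low _ g T n e (fun a b => sq_term
            (fun i => if i is 0%N then a else b) 0 1 x y) k kn).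
- apply: funext => y.
  exact: (@sum_extend_low _ g T n e (fun a b => der_term
            (fun i => if i is 0%N then a else b) 0 1 x y) k kn).
- exact: (@sum_extend_low _ g T n e (fun a b => dersq_term
            (fun i => if i is 0%N then a else b) 0 1 x) k kn).
Qed.

(** The extreme terms of the sum and [theta2 P e] have the same summands only up
    to the order of the arguments of the bracket and of [e.1.1]: alternating
    maps are symmetric in characteristic 2. *)
Lemma defect_extend : is_cochain2_ResLD e ->
  defect (extend T n e) n.+1 = ob_cochain T + theta2 P e.
Proof.
move=> eP; have [T0 TP _] := deformationP T.
have V2 (x : g) : x + x = 0 := ObstructionCocycle.g2 charF x.
have eC x y : e.1.1 x y = e.1.1 y x.
  exact: (ObstructionCocycle.muC charF (c := fun=> e) (fun=> eP) 0).
have brC x y : bracket P x y = bracket P y x.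
  have := ObstructionCocycle.muC charF (c := fun=> T 0%N)
            (fun=> TP 0%N (leq0n n)) 0 x y.
  by rewrite T0.
have extE := @sum_extend_top _ g T n e; rewrite T0 in extE.
case: e eP eC extE => -[f w] h _ /= eC extE.
congr pair; congr pair; apply: funext => x.
- apply: funext => y; apply: funext => z.
  apply: etrans (extE (fun a b => jac_term
            (fun i => if i is 0%N then a else b) 0 1 x y z)) _.
  congr (_ + _); rewrite /jac_term /=.
  rewrite (eC z x) (eC x (bracket P y z)) (eC y (bracket P z x)).
  rewrite (eC z (bracket P x y)) (brC z x).
  by apply: (ObstructionCocycle.eq2 V2); ObstructionCocycle.cancel2 V2.
- apply: funext => y; apply: etrans (extE (fun a b => sq_term
            (fun i => if i is 0%N then a else b) 0 1 x y)) _.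
  congr (_ + _); rewrite /sq_term /= (eC y (sq P x)) (eC x (bracket P x y)).
  by apply: (ObstructionCocycle.eq2 V2); ObstructionCocycle.cancel2 V2.
- apply: funext => y; apply: etrans (extE (fun a b => der_term
            (fun i => if i is 0%N then a else b) 0 1 x y)) _.
  congr (_ + _); rewrite /der_term /= ?fctE (eC y (der P x)).
  by apply: (ObstructionCocycle.eq2 V2); ObstructionCocycle.cancel2 V2.
- apply: etrans (extE (fun a b => dersq_term
            (fun i => if i is 0%N then a else b) 0 1 x)) _.
  congr (_ + _); rewrite /dersq_term /= ?fctE.
  by apply: (ObstructionCocycle.eq2 V2); ObstructionCocycle.cancel2 V2.
Qed.

Lemma is_deformation_extend : is_cochain2_ResLD e ->
  is_deformation P n.+1 (extend T n e) <-> theta2 P e = ob_cochain T.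
Proof.
move=> eP; have [T0 TP _] := deformationP T.
have Ob2 : ob_cochain T + ob_cochain T = 0.
  by congr pair; congr pair; do ?apply: funext => ?;
     exact: (ObstructionCocycle.g2 charF).
split=> [/is_deformationE[_ _ /(_ n.+1 (leqnn _))]|obE].
  by rewrite defect_extend // -[RHS]Ob2 => /addrI.
apply/is_deformationE; split=> [|i|k]; first by rewrite extend_low.
- rewrite leq_eqVlt => /predU1P[->|]; first by rewrite extend_top.
  by rewrite ltnS => i_le; rewrite extend_low //; apply: TP.
- rewrite leq_eqVlt => /predU1P[->|]; first by rewrite defect_extend // obE.
  by rewrite ltnS; apply: defect_extend_low.
Qed.

End Extension.

Lemma pi_H3_eq0 (z : Z3_ResLD P) :
  (\pi_(H3_ResLD P) z)%qT = 0 :> H3_ResLD P <->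
  exists2 e, is_cochain2_ResLD e & theta2 P e = val z.
Proof.
have B3P : reflect (exists2 e, is_cochain2_ResLD e & theta2 P e = val z)
  (z \in @B3 F g P) by exact: asboolP.
have <- : (\pi_(H3_ResLD P) 0)%qT = 0 :> H3_ResLD P by rewrite -pi_zeror.
have piE : (z \in @B3 F g P) = (z == 0 %[mod H3_ResLD P])%qT.
  by rewrite -Quotient.idealrBE subr0.
split=> [/eqP|/B3P].
  by rewrite -piE => /B3P.
by rewrite piE => /eqP.
Qed.

End Obstruction.

Theorem theorem4p13 (F : fieldType) (charF : 2%N \in [pchar F])
    (g : lmodType F) (P : resLieDer g) (n : nat) (T : deformation P n) :
  extensible T <-> obstruction_class charF T = 0 :> H3_ResLD P.
Proof.
rewrite /obstruction_class pi_H3_eq0.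
by split=> -[e eP /(is_deformation_extend charF T eP) ?]; exists e.
Qed.
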